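(* Let $n\ge2$. The matrix weight $W^{\omega_1}_{\mathrm{pol}}$ on $S=\phi(A_c)$ is indecomposable: there do not exist a constant invertible matrix $M$ and matrix weights $W_1,\dots,W_r$ on $S$ of sizes strictly smaller than $n+1$ such that $M\,W^{\omega_1}_{\mathrm{pol}}(x)\,M^*=\mathrm{diag}(W_1(x),\dots,W_r(x))$ (block diagonal) for all $x\in S$.
   Context: A matrix weight of size $N$ on a set $S$ is a function on $S$ with values in the self-adjoint $N\times N$ matrices. $G=\mathrm{SL}(n+1,\mathbb{C})\times\mathrm{SL}(n+1,\mathbb{C})$, $H$ is the diagonal subgroup, $A_c=\{(t,t^{-1})\mid t\text{ diagonal in }\mathrm{SU}(n+1)\}$. On $A_c$, $\phi=(\phi_1,\dots,\phi_n)$ with $\phi_i(t,t^{-1})=\binom{n+1}{i}^{-1}\sum_{j_1<\dots<j_i}t_{j_1}^2\cdots t_{j_i}^2$. $V=\mathbb{C}^{n+1}$ has standard orthonormal basis $e_1,\dots,e_{n+1}$. For $m=1,\dots,n+1$ the irreducible $G$-module $V_m=\bigwedge^mV\otimes\bigwedge^{n+2-m}V$ (first factor of $G$ acting on the first tensor factor, second on the second), with its standard $\mathrm{SU}(n+1)\times\mathrm{SU}(n+1)$-invariant inner product, contains $V$ exactly once on restriction to $H$; let $j_m:V\to V_m$ be an isometric $H$-equivariant embedding and $p_m=j_m^*$. For $a\in A_c$, $p_m\circ a\circ j_m$ is diagonal in the basis $(e_i)$; $\Phi^{\omega_1}_0(a)$ is the $(n+1)\times(n+1)$ matrix whose $(i,m)$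 entry is the scalar by which $p_m\circ a\circ j_m$ acts on $e_i$. $W^{\omega_1}_{\mathrm{pol}}$ is the $\mathrm{End}(\mathbb{C}^{n+1})$-valued polynomial in $n$ variables determined by $W^{\omega_1}_{\mathrm{pol}}(\phi(a))=\Phi^{\omega_1}_0(a)^*\,\Phi^{\omega_1}_0(a)$ for $a\in A_c$. *)

(* Defs.v *)
From HB Require Import structures.
From mathcomp Require Import all_boot all_order all_algebra.
From mathcomp Require Import classical_sets reals.
From mathcomp Require Import complex mxtens mpoly.
Set Implicit Arguments.
Unset Strict Implicit.
Unset Printing Implicit Defensive.
Import Order.TTheory GRing.Theory Num.Theory.
Local Open Scope classical_set_scope.
Local Open Scope ring_scope.
Local Open Scope sesquilinear_scope.

(* Linear maps are matrices acting on column vectors, and the coordinate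
   spaces carry the standard Hermitian inner product. *)

(* [incr k N] indexes the basis e_{u_1} /\ ... /\ e_{u_k}, u_1 < ... < u_k, of
   the k-th exterior power of C^N; this basis is orthonormal for the standard
   U(N)-invariant inner product. *)
Definition incr (k N : nat) : finType :=
  {u : k.-tuple 'I_N | sorted ltn [seq val i | i <- u]}.

(* The k-th exterior power of g: the coefficient of g (e_{v_1} /\ ... /\ e_{v_k})
   at e_{u_1} /\ ... /\ e_{u_k} is the minor of g with rows u and columns v. *)
Definition extmx (C : comNzRingType) (k N : nat) (g : 'M[C]_N)
    : 'M[C]_#|incr k N| :=
  \matrix_(u, v) \det (mxsub (tnth (val (enum_val u)))
                             (tnth (val (enum_val v))) g).

Section Modules.
Variables (C : numClosedFieldType) (n : nat).

(* The indices m = 1, ..., n+1 are shifted: m : 'I_n.+1 stands for m.+1, so that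
   n + 2 - m.+1 = n.+1 - m. *)
Definition dimV (m : 'I_n.+1) : nat :=
  (#|incr m.+1 n.+1| * #|incr (n.+1 - m) n.+1|)%N.

Definition actV (m : 'I_n.+1) (g : 'M[C]_n.+1 * 'M[C]_n.+1) : 'M[C]_(dimV m) :=
  extmx m.+1 g.1 *t extmx (n.+1 - m) g.2.

Definition H_equivariant (m : 'I_n.+1) (j : 'M[C]_(dimV m, n.+1)) : Prop :=
  forall h : 'M[C]_n.+1, \det h = 1 -> actV m (h, h) *m j = j *m h.

Definition isometric (p q : nat) (j : 'M[C]_(p, q)) : Prop :=
  j^t* *m j = 1%:M.

Definition A_c : set ('M[C]_n.+1 * 'M[C]_n.+1) :=
  [set a | exists t : 'M[C]_n.+1,
     [/\ is_diag_mx t, t \is unitarymx, \det t = 1 & a = (t, invmx t)]].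

(* i : 'I_n stands for the index i.+1. *)
Definition phi (a : 'M[C]_n.+1 * 'M[C]_n.+1) : 'I_n -> C := fun i =>
  ('C(n.+1, i.+1)%:R)^-1 *
  \sum_(J : {set 'I_n.+1} | #|J| == i.+1) \prod_(k in J) a.1 k k ^+ 2.

(* For a in A_c the matrix of p_m o a o j_m is diagonal, so the scalar by which
   it acts on e_i is its (i, i) entry. *)
Definition Phi0 (j : forall m : 'I_n.+1, 'M[C]_(dimV m, n.+1))
    (a : 'M[C]_n.+1 * 'M[C]_n.+1) : 'M[C]_n.+1 :=
  \matrix_(i, m) ((j m)^t* *m actV m a *m j m) i i.

Definition mpolymx_eval (N : nat) (W : 'M[{mpoly C[n]}]_N) (x : 'I_n -> C)
    : 'M[C]_N :=
  map_mx (fun p : {mpoly C[n]} => p.@[x]) W.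

End Modules.

Section Weights.
Variables (C : numClosedFieldType) (T : Type).

(* Weights on S are total functions of which only the values on S matter. *)
Definition matrix_weight (N : nat) (S : set T) (W : T -> 'M[C]_N) : Prop :=
  forall x, S x -> (W x)^t* = W x.

Definition decomposable (N : nat) (S : set T) (W : T -> 'M[C]_N) : Prop :=
  exists (M : 'M[C]_N) (r : nat) (s : 'I_r -> nat)
         (eqN : (\sum_k s k)%N = N) (Ws : forall k : 'I_r, T -> 'M[C]_(s k)),
    [/\ M \in unitmx,
        forall k, (s k < N)%N,
        forall k, matrix_weight S (Ws k)
      & forall x, S x ->
          M *m W x *m M^t* = castmx (eqN, eqN) (\mxdiag_k Ws k x)].

Definition indecomposable (N : nat) (S : set T) (W : T -> 'M[C]_N) : Prop :=
  ~ decomposable S W.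

End Weights.

(* Main.v *)
(* Put x = t^2 for a = (t, t^-1). The torus weights of j_m show that
   Phi0 i m = t_i^-1 psi_m x i, where psi_m x i is a convex combination of the
   monomials x_I with |I| = m + 1 and i \in I; hence the weight depends on x only.
   A decomposition yields a nonscalar A with A W(x) = W(x) A^* for all x.
   Multiplying x by an (n+1)-st root of unity z multiplies W_{k,m} by z^(m-k), so
   Fourier inversion gives
     A_{m,k} W_{k,m'}(x) = W_{m,l}(x) conj(A_{m',l}) if m + m' = k + l mod n + 1.
   At x = 1 all entries of W are equal, so A is circulant; then
   A_{0,l} (W_{l,l} - W_{0,0}) = 0. As W_{0,0} = n + 1 everywhere while
   W_{l,l} < n + 1 at a suitable sign vector x for 0 < l < n, A is scalar. *)
Require Import Defs.
From HB Require Import structures.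
From mathcomp Require Import all_boot all_order all_algebra.
From mathcomp Require Import fingroup perm cyclic separable cyclotomic.
From mathcomp Require Import classical_sets reals.
From mathcomp Require Import complex mxtens mpoly ring.
Set Implicit Arguments.
Unset Strict Implicit.
Unset Printing Implicit Defensive.
Import Order.TTheory GRing.Theory Num.Theory.
Local Open Scope classical_set_scope.
Local Open Scope ring_scope.
Local Open Scope sesquilinear_scope.

(** * Roots of unity; from block decompositions to intertwiners *)

Lemma primitive_root_exists (C : numClosedFieldType) n :
  (0 < n)%N -> exists z : C, n.-primitive_root z.
Proof.
pose p : {poly C} := 'X^n - 1; have [r Dp] := closed_field_poly_normal p.
move=> n_gt0; rewrite (monicP _) ?monicXnsubC // scale1r in Dp.
have rn1: all n.-unity_root r by apply/allP=> z; rewrite -root_prod_XsubC -Dp.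
have sz_r: (n < (size r).+1)%N.
  by rewrite -(size_prod_XsubC r id) -Dp size_XnsubC.
have [|z] := hasP (has_prim_root n_gt0 rn1 _ sz_r); last by exists z.
by rewrite -separable_prod_XsubC -Dp separable_Xn_sub_1 // pnatr_eq0 -lt0n.
Qed.

Lemma conjCtM (C : numClosedFieldType) (m n p : nat) (A : 'M[C]_(m, n))
    (B : 'M[C]_(n, p)) : (A *m B)^t* = B^t* *m A^t*.
Proof. by rewrite trmx_mul map_mxM. Qed.

(** Coarsening to two parts: [b] is the block containing the index 0, and its complement is nonempty
    because every block is smaller than [N]. *)
Lemma decomposable_split (C : numClosedFieldType) (T : Type) (N : nat)
    (S : set T) (W : T -> 'M[C]_N) : (0 < N)%N -> decomposable S W ->
  exists (M : 'M[C]_N) (b : pred 'I_N),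
    [/\ M \in unitmx, exists i, b i, exists i, ~~ b i
      & forall x, S x -> forall i k, b i != b k -> (M *m W x *m M^t*) i k = 0].
Proof.
move=> N_gt0 [M [r [s [eqN [Ws [Mu sN _ MW]]]]]].
case: _ / eqN in W M N_gt0 Mu sN MW *.
exists M, (fun i => tagnat.sig1 i == tagnat.sig1 (Ordinal N_gt0)).
split=> //; first by exists (Ordinal N_gt0).
- apply/existsP; apply: contraT; rewrite negb_exists => /forallP same; exfalso.
  set k0 := tagnat.sig1 (Ordinal N_gt0) in same.
  have := sN k0; rewrite (bigD1 k0)//= big1 ?addn0 ?ltnn// => k kk0.
  apply/eqP; rewrite -leqn0 leqNgt; apply/negP => sk.
  by have := same (tagnat.Rank k (Ordinal sk)); rewrite /= tagnat.Rank1K kk0.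
- move=> x Sx i k bik; rewrite MW// castmx_id /mxdiag mxE.
  have [e|_] := eqVneq (tagnat.sig1 i) (tagnat.sig1 k); last by rewrite mxE.
  by rewrite e eqxx in bik.
Qed.

(** Conjugating the coordinate projection [P] onto [b] by [M] gives [A]: [P] is self-adjoint and
    commutes with [M *m W x *m M^t*], whose entries between the two parts vanish. *)
Lemma decomposable_intertwiner (C : numClosedFieldType) (T : Type) (N : nat)
    (S : set T) (W : T -> 'M[C]_N) : (0 < N)%N -> decomposable S W ->
  exists A : 'M[C]_N, ~~ is_scalar_mx A /\
    forall x, S x -> A *m W x = W x *m A^t*.
Proof.
move=> N_gt0 /(decomposable_split N_gt0)[M [b [Mu [i bi] [k bk] MW]]].
pose P : 'M[C]_N := diag_mx (\row_i (b i)%:R).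
have P_adj : P^t* = P.
  by apply/matrixP => u v; rewrite !mxE rmorphMn /= conjC_nat eq_sym; case: eqP => [->|].
have [A MA] : exists A, M *m A = P *m M.
  by exists (invmx M *m P *m M); rewrite -mulmxA mulKVmx.
exists A; split.
  apply/negP => /is_scalar_mxP[c Ac].
  have Pc : P = c%:M.
    have := MA; rewrite Ac scalar_mxC => /(congr1 (mulmx^~ (invmx M))).
    by rewrite !mulmxK.
  have := congr1 (fun X : 'M_N => X i i) Pc; rewrite !mxE eqxx bi /= => c1.
  have := congr1 (fun X : 'M_N => X k k) Pc; rewrite !mxE eqxx (negbTE bk) /=.
  by rewrite -c1 => /eqP; rewrite eq_sym oner_eq0.
move=> x Sx; set D := M *m W x *m M^t*.
have PD : P *m D = D *m P.
  apply/matrixP => u v; rewrite mul_diag_mx mul_mx_diag !mxE mulrC.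
  have [->|buv] := eqVneq (b u) (b v); first by [].
  by have := MW x Sx u v buv; rewrite -/D !mxE => ->; rewrite !mul0r.
have Mtu : M^t* \in unitmx by rewrite map_unitmx unitmx_tr.
apply: (can_inj (mulKmx Mu)); apply: (can_inj (mulmxK Mtu)).
rewrite mulmxA MA -!mulmxA -conjCtM MA conjCtM P_adj !mulmxA.
by move: PD; rewrite /D !mulmxA.
Qed.

(** * Fourier separation and scalar intertwiners *)

Lemma sum_unity_root (C : numClosedFieldType) n (w : C) : w ^+ n.+1 = 1 ->
  \sum_(s < n.+1) w ^+ s = n.+1%:R *+ (w == 1).
Proof.
move=> wN; case: eqP => [->|/eqP w1].
  by under eq_bigr do rewrite expr1n; rewrite sumr_const card_ord.
apply: (mulfI (x := w - 1)); first by rewrite subr_eq0.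
by rewrite -subrX1 wN subrr mulr0.
Qed.

(** For [k != k0] the sum over [s] is a full geometric sum of a nontrivial root of unity, hence 0;
    primitivity makes the ratio 1 only at [k0]. *)
Lemma fourier_inversion (C : numClosedFieldType) n (z : C)
    (f : 'I_n.+1 -> C) (k0 : 'I_n.+1) : n.+1.-primitive_root z ->
  \sum_(s < n.+1) \sum_k f k * (z ^+ k0 / z ^+ k) ^+ s = n.+1%:R * f k0.
Proof.
move=> z_prim; have z_neq0 : z != 0 by rewrite (prim_root_eq0 z_prim).
rewrite exchange_big /= (bigD1 k0)//= [X in _ + X]big1 ?addr0 => [|k kk0].
  rewrite divff ?expf_neq0//.
  by under eq_bigr do rewrite expr1n mulr1; rewrite sumr_const card_ord mulr_natl.
rewrite -mulr_sumr sum_unity_root; last first.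
  by rewrite exprMn exprVn ![_ ^+ _ ^+ n.+1]exprAC (prim_expr_order z_prim)
    !expr1n divr1.
suff /negbTE-> : z ^+ k0 / z ^+ k != 1 by rewrite mulr0.
apply/negP => /eqP/(canRL (divfK _)); rewrite expf_neq0// => /(_ isT).
rewrite mul1r => /eqP; rewrite (eq_prim_root_expr z_prim) !modn_small// => /eqP.
by move/val_inj/esym/eqP; rewrite (negbTE kk0).
Qed.

(* The twists of [W] by the powers of [z] separate the diagonals modulo n + 1
   of the intertwining relation. *)
Lemma twisted_intertwiner (C : numClosedFieldType) n (z : C)
    (A W : 'M[C]_n.+1) : n.+1.-primitive_root z ->
  (forall s : nat,
     let Wz := \matrix_(i, k) ((z ^+ k / z ^+ i) ^+ s * W i k) in
     A *m Wz = Wz *m A^t*) ->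
  forall m m' k l : 'I_n.+1, (m + m' = k + l %[mod n.+1])%N ->
    A m k * W k m' = W m l * (A m' l)^*.
Proof.
move=> z_prim AW m m' k l mod_eq.
have z_neq0 : z != 0 by rewrite (prim_root_eq0 z_prim).
have zV_prim : n.+1.-primitive_root z^-1.
  have -> : z^-1 = z ^+ n.
    by apply: (mulIf z_neq0); rewrite mulVf// -exprSr (prim_expr_order z_prim).
  by rewrite (prim_root_exp_coprime _ z_prim) coprimenS.
apply: (mulfI (x := n.+1%:R)); first by rewrite pnatr_eq0.
(* On the right the summation index enters the twist with the opposite exponent, hence the second
   inversion with [z^-1]. *)
rewrite -(fourier_inversion (fun k => A m k * W k m') k z_prim).
rewrite -(fourier_inversion (fun l => W m l * (A m' l)^*) l zV_prim).
have z_exp : z ^+ k * z ^+ l = z ^+ m * z ^+ m'.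
  by apply/eqP; rewrite -!exprD (eq_prim_root_expr z_prim) eq_sym; apply/eqP.
apply: eq_bigr => s _.
(* Rescaled by this factor, the [(m, m')] entry of the twisted relation is the [s]-th term of both
   Fourier sums; on the right this uses [z_exp]. *)
have := congr1 (fun X : 'M_n.+1 => (z ^+ k / z ^+ m') ^+ s * X m m') (AW s).
rewrite !mxE => AWs.
transitivity (\sum_i (z ^+ k / z ^+ m') ^+ s * (A m i *
   (\matrix_(i, k) ((z ^+ k / z ^+ i) ^+ s * W i k)) i m')).
  apply: eq_bigr => i _; rewrite !mxE.
  have -> : z ^+ k / z ^+ i = (z ^+ k / z ^+ m') * (z ^+ m' / z ^+ i).
    by rewrite mulrA divfK ?expf_neq0.
  by rewrite exprMn; ring.
rewrite -mulr_sumr AWs mulr_sumr; apply: eq_bigr => i _; rewrite !mxE.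
have -> : z^-1 ^+ l / z^-1 ^+ i = (z ^+ k / z ^+ m') * (z ^+ i / z ^+ m).
  have -> : z^-1 ^+ l = z ^+ k / (z ^+ m * z ^+ m').
    by rewrite -z_exp invfM mulVKf ?expf_neq0// exprVn.
  by rewrite exprVn invrK invfM; ring.
by rewrite [in RHS]exprMn [RHS]mulrC !mulrA.
Qed.

Lemma scalar_intertwiner (C : numClosedFieldType) n (z c : C)
    (X : set ('I_n.+1 -> C)) (W : ('I_n.+1 -> C) -> 'M[C]_n.+1)
    (A : 'M[C]_n.+1) :
  (2 <= n)%N -> n.+1.-primitive_root z -> c != 0 ->
  X (fun=> 1) -> W (fun=> 1) = const_mx c ->
  (forall x (s : nat), X x -> X (fun i => z ^+ s * x i)) ->
  (forall x (s : nat) i k, X x ->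
     W (fun i => z ^+ s * x i) i k = (z ^+ k / z ^+ i) ^+ s * W x i k) ->
  (forall x, X x -> W x 0 0 = c) ->
  (forall l : 'I_n.+1, (0 < l < n)%N -> exists2 x, X x & W x l l != c) ->
  (forall x, X x -> A *m W x = W x *m A^t*) -> is_scalar_mx A.
Proof.
move=> n_ge2 z_prim c0 X1 W1 Xz Wz W00 Wll AW.
have rel x : X x -> forall m m' k l : 'I_n.+1,
    (m + m' = k + l %[mod n.+1])%N -> A m k * W x k m' = W x m l * (A m' l)^*.
  move=> Xx; apply: (twisted_intertwiner z_prim) => s /=.
  set Ws := \matrix_(i, k) _.
  have -> : Ws = W (fun i => z ^+ s * x i).
    by apply/matrixP => i k; rewrite mxE Wz.
  by rewrite -AW//; exact: Xz.
(* At the constant point 1 the common entry [c] cancels. Applied twice, this says that [A m k]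
   depends only on [m - k] modulo n + 1. *)
have circ (m m' k l : 'I_n.+1) :
    (m + m' = k + l %[mod n.+1])%N -> A m k = (A m' l)^*.
  move=> /(rel _ X1); rewrite W1 !mxE mulrC; exact: mulfI.
have small (l : 'I_n.+1) : (0 < l < n)%N -> A 0 l = 0.
  move=> /Wll[x Xx Wx].
  (* [circ] turns [(A l 0)^*] into [A 0 l], so the relation reads [A 0 l * (W x l l - c) = 0]. *)
  have := rel x Xx 0 l l 0; rewrite addnC => /(_ erefl).
  rewrite W00// (circ l 0 0 l) 1?addnC// conjCK mulrC.
  move/eqP; rewrite -subr_eq0 -mulrBl mulf_eq0 subr_eq0 (negbTE Wx) /=.
  by move/eqP.
have row0 (l : 'I_n.+1) : l != 0 -> A 0 l = 0.
  move=> l0; have l_gt0 : (0 < l)%N by rewrite lt0n.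
  have [ln|ln] := ltnP l n; first by rewrite small// l_gt0.
  (* The remaining entry [A 0 n] is conjugate to [A 0 1], as 0 + 0 = n + 1 modulo n + 1; [n >= 2]
     puts 1 in the range of [small]. *)
  have le_n : l = n :> nat by apply/eqP; rewrite eqn_leq ln -ltnS ltn_ord.
  have n_gt1 : (1 < n.+1)%N by exact: leqW.
  rewrite (circ 0 0 l (Ordinal n_gt1)) ?small ?conjC0//=.
  by rewrite le_n addn1 modnn mod0n.
have offdiag (m k : 'I_n.+1) : m != k -> A m k = 0.
  (* The index [m - k] modulo n + 1 moves the entry to row 0; it is 0 only if [m = k]. *)
  move=> mk; rewrite (circ m 0 k (inord ((m + (n.+1 - k)) %% n.+1))); last first.
    rewrite inordK ?ltn_mod// modnDmr addnCA subnKC ?modnDr ?addn0//.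
    by rewrite ltnW.
  rewrite row0 ?conjC0// -val_eqE /= inordK ?ltn_mod//.
  apply: contra mk => /eqP m0; apply/eqP/val_inj; apply/eqP => /=.
  rewrite -[X in X == _](modn_small (ltn_ord m)) -[X in _ == X](modn_small (ltn_ord k)).
  rewrite -(eqn_modDr (n.+1 - k)) subnKC; last by rewrite ltnW.
  by rewrite m0 modnn.
apply/is_scalar_mxP; exists (A 0 0); apply/matrixP => i k; rewrite mxE.
have [->|/offdiag//] := eqVneq i k.
by rewrite (circ k 0 k 0 erefl) [RHS](circ 0 0 0 0 erefl).
Qed.

(** * Exterior powers of monomial matrices *)

Section Exterior.
Variables (k N : nat).
Implicit Types u v : 'I_#|incr k N|.

(** Basis vectors are handled through their supports: permutations act on [k]-subsets without
    reordering tuples. *)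
Definition isupp u : {set 'I_N} := [set i in val (val (enum_val u))].

Lemma uniq_incr u : uniq (val (val (enum_val u))).
Proof.
apply: (@map_uniq _ _ val).
exact: (sorted_uniq ltn_trans ltnn (valP (enum_val u))).
Qed.

Lemma card_isupp u : #|isupp u| = k.
Proof. by rewrite cardsE (card_uniqP (uniq_incr u)) size_tuple. Qed.

Lemma isupp_inj : injective isupp.
Proof.
move=> u v uv; apply: enum_val_inj; apply: val_inj; apply: val_inj.
apply: (inj_map val_inj).
apply: (irr_sorted_eq ltn_trans ltnn (valP (enum_val u)) (valP (enum_val v))).
have e : val (val (enum_val u)) =i val (val (enum_val v)).
  by move=> i; have /setP/(_ i) := uv; rewrite !inE.
exact: eq_mem_map e.
Qed.

Lemma isupp_surj (B : {set 'I_N}) : #|B| = k -> exists u, isupp u = B.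
Proof.
move=> Bk; have sz : size (enum B) == k by rewrite -cardE Bk.
have srt : sorted ltn [seq val i | i <- Tuple sz].
  apply: (subseq_sorted ltn_trans _ (iota_ltn_sorted 0 N)).
  by rewrite -val_enum_ord map_subseq// [enum 'I_N]enumT filter_subseq.
pose u : incr k N := exist _ (Tuple sz) srt.
by exists (enum_rank u); apply/setP => i; rewrite inE enum_rankK /= mem_enum.
Qed.

Lemma prod_isupp (C : comNzRingType) (d : 'I_N -> C) u :
  \prod_a d (tnth (val (enum_val u)) a) = \prod_(i in isupp u) d i.
Proof.
rewrite -(big_tuple _ _ (val (enum_val u)) xpredT) big_uniq ?uniq_incr//=.
by apply: eq_bigl => i; rewrite inE.
Qed.

(** Sends [e_l] to [d (s l)] times [e_(s l)]; diagonal matrices and signed transpositions are both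
    of this form. *)
Definition monomial_mx (C : comNzRingType) (d : 'I_N -> C) (s : {perm 'I_N}) :=
  \matrix_(i, l) (d i *+ (i == s l)) : 'M[C]_N.

(** Either the minor has a zero row, or every row index lies in [s @: isupp v], and equal
    cardinalities then force equality of supports. *)
Lemma extmx_monomial_eq0 (C : comNzRingType) (d : 'I_N -> C) (s : {perm 'I_N})
    u v : isupp u != s @: isupp v -> extmx k (monomial_mx d s) u v = 0.
Proof.
move=> uv; rewrite mxE.
have [/existsP[a /forallP ua]|] := boolP [exists a, forall b,
    tnth (val (enum_val u)) a != s (tnth (val (enum_val v)) b)].
  rewrite (expand_det_row _ a) big1// => b _; rewrite !mxE.
  by rewrite (negbTE (ua b)) mulr0n mul0r.
rewrite negb_exists => /forallP all_u.
case/negP: uv; rewrite eqEcard card_imset; last exact: perm_inj.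
rewrite !card_isupp leqnn andbT; apply/fintype.subsetP => i; rewrite inE => /tnthP[a ->].
have := all_u a; rewrite negb_forall => /existsP[b]; rewrite negbK => /eqP->.
by apply: imset_f; rewrite inE mem_tnth.
Qed.

(** The explicit inverse [B], the transposed pattern with reciprocal entries, gives nonvanishing
    without tracking signs. *)
Lemma extmx_monomial_neq0 (F : fieldType) (d : 'I_N -> F) (s : {perm 'I_N})
    u v : (forall i, d i != 0) ->
  isupp u = s @: isupp v -> extmx k (monomial_mx d s) u v != 0.
Proof.
move=> d0 uv; rewrite mxE -unitfE -unitmxE.
set U := tnth (val (enum_val u)); set V := tnth (val (enum_val v)).
have U_inj : injective U by exact/tuple_uniqP/uniq_incr.
have V_inj : injective V by exact/tuple_uniqP/uniq_incr.
pose B := \matrix_(b, a) ((d (U a))^-1 *+ (U a == s (V b))).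
suff : B *m mxsub U V (monomial_mx d s) = 1%:M by case/mulmx1_unit.
apply/matrixP => b b'; rewrite !mxE.
have : s (V b) \in isupp u by rewrite uv imset_f// inE mem_tnth.
rewrite inE => /tnthP[a0]; rewrite -/(U a0) => Ua0.
rewrite (bigD1 a0)//= big1 ?addr0 => [|a aa0].
  rewrite !mxE -Ua0 eqxx mulr1n mulrnAr mulVf//.
  by rewrite (inj_eq perm_inj) (inj_eq V_inj).
by rewrite !mxE Ua0 (inj_eq U_inj) (negbTE aa0) mulr0n mul0r.
Qed.

End Exterior.

Lemma extmx_diag (C : comNzRingType) k N (d : 'rV[C]_N) :
  extmx k (diag_mx d) = diag_mx (\row_u \prod_(i in isupp u) d 0 i).
Proof.
apply/matrixP => u v; rewrite [RHS]mxE.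
have [<-|uv] := eqVneq u v; last first.
  have -> : diag_mx d = monomial_mx (d 0) 1%g.
    by apply/matrixP => i l; rewrite !mxE perm1.
  rewrite extmx_monomial_eq0 ?mulr0n//; apply: contra uv => /eqP.
  rewrite (eq_imset _ (perm1 (T := _))) imset_id => /isupp_inj->.
  exact: eqxx.
rewrite !mxE -prod_isupp.
set U := tnth (val (enum_val u)).
have U_inj : injective U by exact/tuple_uniqP/uniq_incr.
have -> : mxsub U U (diag_mx d) = diag_mx (\row_a d 0 (U a)).
  by apply/matrixP => a b; rewrite !mxE (inj_eq U_inj).
by rewrite det_diag; apply: eq_bigr => a _; rewrite mxE.
Qed.

(** * Weights of an equivariant embedding *)

Section Module.
Variables (C : numClosedFieldType) (n : nat) (m : 'I_n.+1).
Implicit Types w : 'I_(dimV m).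

Definition suppl w : {set 'I_n.+1} := isupp (mxtens_unindex w).1.
Definition suppr w : {set 'I_n.+1} := isupp (mxtens_unindex w).2.

Lemma card_suppl w : #|suppl w| = m.+1. Proof. exact: card_isupp. Qed.

Lemma supp_inj w w' : suppl w = suppl w' -> suppr w = suppr w' -> w = w'.
Proof.
move=> /isupp_inj e1 /isupp_inj e2; apply: (can_inj (@mxtens_unindexK _ _)).
by rewrite [LHS]surjective_pairing e1 e2 -surjective_pairing.
Qed.

Lemma supp_surj (A B : {set 'I_n.+1}) : #|A| = m.+1 -> #|B| = (n.+1 - m)%N ->
  exists w, suppl w = A /\ suppr w = B.
Proof.
move=> /isupp_surj[u uA] /isupp_surj[v vB]; exists (mxtens_index (u, v)).
by rewrite /suppl /suppr mxtens_indexK.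
Qed.

Lemma actV_diag (d e : 'rV[C]_n.+1) :
  actV m (diag_mx d, diag_mx e) =
  diag_mx (\row_w ((\prod_(i in suppl w) d 0 i) * \prod_(i in suppr w) e 0 i)).
Proof.
apply/matrixP => w w'; rewrite /actV !extmx_diag !mxE mulrnAl mulrnAr -mulrnA.
rewrite mulnb andbC; congr (_ *+ nat_of_bool _).
by rewrite -(can_eq (@mxtens_unindexK _ _) w w') -pair_eqE.
Qed.

Variable j : 'M[C]_(dimV m, n.+1).
Hypothesis j_equivariant : H_equivariant j.

(** Equivariance under the diagonal torus lets [j] pair only vectors of equal weight. *)
Lemma equivariant_weight w i (d : 'I_n.+1 -> C) : j w i != 0 ->
  \prod_k d k = 1 ->
  (\prod_(k in suppl w) d k) * (\prod_(k in suppr w) d k) = d i.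
Proof.
move=> jwi d1; pose D := \row_k d k.
have detD : \det (diag_mx D) = 1.
  by rewrite det_diag -[RHS]d1; apply: eq_bigr => k _; rewrite mxE.
have := congr1 (fun X : 'M_(_, _) => X w i) (j_equivariant detD).
rewrite actV_diag mul_diag_mx mul_mx_diag !mxE [RHS]mulrC => /(mulIf jwi).
have pD (A : {set 'I_n.+1}) : \prod_(k in A) D 0 k = \prod_(k in A) d k.
  by apply: eq_bigr => k _; rewrite mxE.
by rewrite !pD.
Qed.

Lemma prod_expr_eq (c : C) (P : pred 'I_n.+1) a :
  \prod_(k | P k) c ^+ (k == a) = c ^+ P a.
Proof.
have [Pa|Pa] := boolP (P a).
  rewrite (bigD1 a)//= eqxx big1 ?mulr1// => k /andP[_ /negbTE->]//.
by rewrite big1// => k Pk; case: eqP => // ka; rewrite -ka Pk in Pa.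
Qed.

(* A coroot element with eigenvalues i and -i tests the weight of [w] at the
   two coordinates [i] and [q]. *)
Lemma mem_suppl w i : (0 < n)%N -> j w i != 0 -> i \in suppl w.
Proof.
move=> n_gt0 jwi; apply: contraT => iw.
have weight q : q != i -> 'i ^+ (i \in suppr w) * (- 'i) ^+ (q \in suppl w) *
    (- 'i) ^+ (q \in suppr w) = 'i :> C.
  move=> qi; pose d k : C := 'i ^+ (k == i) * (- 'i) ^+ (k == q).
  have d1 : \prod_k d k = 1.
    rewrite big_split /= !prod_expr_eq.
    by rewrite mulrN -expr2 sqrCi opprK.
  have := equivariant_weight jwi d1; rewrite !big_split /= !prod_expr_eq.
  rewrite (negbTE iw) /d eqxx eq_sym (negbTE qi) expr0 mulr1 mul1r expr1 => e.
  by rewrite -[RHS]e mulrCA mulrA.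
have i_neqN1 : 'i != -1 :> C.
  apply/eqP => /(congr1 (fun x => x ^+ 2)); rewrite sqrCi sqrrN expr1n => /eqP.
  by rewrite eqr_oppLR -subr_eq0 opprK -mulr2n pnatr_eq0.
have i_neq1 : 'i != 1 :> C.
  apply/eqP => /(congr1 (fun x => x ^+ 2)); rewrite sqrCi expr1n => /eqP.
  by rewrite eqr_oppLR -subr_eq0 opprK -mulr2n pnatr_eq0.
have i_neqNi : 'i != - 'i :> C.
  by rewrite -subr_eq0 opprK -mulr2n mulrn_eq0 /= neq0Ci.
have NiNi : - 'i * - 'i = -1 :> C by rewrite mulrNN -expr2 sqrCi.
(* If [q] were in [suppl w], the left side of [weight] would be -i, 1 or -1, never i. So [suppl w]
   would be empty, against its size [m.+1]. *)
have qw q : q != i -> q \notin suppl w.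
  move=> /weight/esym/eqP; apply: contraL => ->.
  case: (i \in suppr w); case: (q \in suppr w); rewrite ?expr1 ?expr0 ?mulr1 ?mul1r //.
  - by rewrite -mulrA NiNi mulrN1.
  - by rewrite mulrN -expr2 sqrCi opprK.
  - by rewrite NiNi.
have /eqP : #|suppl w| = 0%N.
  apply/eqP; rewrite cards_eq0 -finset.subset0; apply/fintype.subsetP => q.
  have [->|/qw/negbTE->//] := eqVneq q i.
  by rewrite (negbTE iw).
by rewrite card_suppl.
Qed.

(* Equivariance under a transposition, with a sign making it unimodular. *)
Lemma transposition_neq0 w i p q : i != p -> i != q -> p != q ->
  j w i != 0 -> exists w', suppl w' = tperm p q @: suppl w /\ j w' i != 0.
Proof.
move=> ip iq pq jwi; set s := tperm p q.
have card_s (A : {set 'I_n.+1}) : #|s @: A| = #|A|.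
  by rewrite card_imset//; exact: perm_inj.
have [||w' [w'l w'r]] := @supp_surj (s @: suppl w) (s @: suppr w).
- by rewrite card_s card_suppl.
- by rewrite card_s card_isupp.
exists w'; split=> //.
have si : s i = i by apply: tpermD; rewrite eq_sym.
pose d k : C := (-1) ^+ (k == p).
have d0 k : d k != 0 by rewrite /d signr_eq0.
pose h := monomial_mx d s.
have det_h : \det h = 1.
  have -> : h = diag_mx (\row_k d k) *m perm_mx s.
    apply/matrixP => k l; rewrite mul_diag_mx !mxE -[k == s l](inj_eq (@perm_inj _ s)).
    by rewrite tpermK mulr_natr.
  rewrite det_mulmx det_diag det_perm odd_tperm pq.
  under eq_bigr do rewrite mxE.
  by rewrite prod_expr_eq mulrNN mulr1.
have := congr1 (fun X : 'M_(_, _) => X w' i) (j_equivariant det_h).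
(* The supports of [w'] single out column [w] of the action, and column [i] of [h] is supported at
   [i]; each side reduces to one term. *)
rewrite !mxE (bigD1 w)//= big1 ?addr0 => [|v vw]; last first.
  rewrite mxE.
  have [vl|vl] := eqVneq (suppl w') (s @: suppl v); last first.
    by rewrite (extmx_monomial_eq0 _ vl) !mul0r.
  have [vr|vr] := eqVneq (suppr w') (s @: suppr v); last first.
    by rewrite (extmx_monomial_eq0 _ vr) mulr0 mul0r.
  case/eqP: vw; apply: supp_inj; apply: (imset_inj (perm_inj (s := s))).
    by rewrite -vl.
  by rewrite -vr.
rewrite (bigD1 i)//= [X in _ + X]big1 ?addr0 => [|l li]; last first.
  rewrite mxE; case: eqP => [sl|]; last by rewrite mulr0.
  by case/eqP: li; rewrite sl si.
move=> e; apply: contraTneq isT => jw'i.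
move/eqP: e; rewrite jw'i mul0r mulf_eq0 (negbTE jwi) orbF mxE mulf_eq0.
by rewrite !(negbTE (extmx_monomial_neq0 d0 _)).
Qed.

(** For isometric [j] the coefficients sum to 1 over [w], so this is an average of squarefree
    monomials of degree [m.+1]. *)
Definition psi (x : 'I_n.+1 -> C) i :=
  \sum_w `|j w i| ^+ 2 * \prod_(k in suppl w) x k.

Hypothesis j_isometric : isometric j.

Lemma col_norm i : \sum_w `|j w i| ^+ 2 = 1.
Proof.
have := congr1 (fun X : 'M_(_, _) => X i i) j_isometric.
rewrite [RHS]mxE eqxx mulr1n mxE => e; rewrite -[RHS]e; apply: eq_bigr => w _.
by rewrite !mxE mulrC normCK.
Qed.

Lemma col_neq0 i : exists w, j w i != 0.
Proof.
apply/existsP; apply: contraT; rewrite negb_exists => /forallP j0.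
have := col_norm i; rewrite big1 => [/eqP|w _]; first by rewrite eq_sym oner_eq0.
by have := j0 w; rewrite negbK => /eqP->; rewrite normr0 expr0n.
Qed.

Lemma psi1 i : psi (fun=> 1) i = 1.
Proof.
by rewrite -[RHS](col_norm i); apply: eq_bigr => w _; rewrite big1 ?mulr1.
Qed.

Lemma psi_scale c x i : psi (fun k => c * x k) i = c ^+ m.+1 * psi x i.
Proof.
rewrite mulr_sumr; apply: eq_bigr => w _.
by rewrite big_split /= prodr_const card_suppl mulrCA.
Qed.

Lemma psi_norm_le1 x i : (forall k, `|x k| = 1) -> `|psi x i| <= 1.
Proof.
move=> x1; rewrite -(col_norm i) (le_trans (ler_norm_sum _ _ _))//.
apply: ler_sum => w _.
by rewrite normrM normr_prod big1// mulr1 normrX normr_id.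
Qed.

Lemma psi_ord0 x i : (0 < n)%N -> m = ord0 -> psi x i = x i.
Proof.
move=> n_gt0 m0; rewrite -[RHS]mul1r -(col_norm i) mulr_suml.
apply: eq_bigr => w _; have [->|jwi] := eqVneq (j w i) 0.
  by rewrite normr0 expr0n !mul0r.
congr (_ * _); have iw := mem_suppl n_gt0 jwi.
suff -> : suppl w = finset.set1 i by rewrite big_set1.
apply/esym/eqP; rewrite eqEcard cards1 card_suppl m0 andbT.
by rewrite finset.sub1set.
Qed.

(** Two vectors occurring in column [i], one with [p] in its support and one with [p] exchanged for
    [q], give monomials of opposite sign, so the average lies strictly between -1 and 1. *)
Lemma psi_lt1 i : (0 < m < n)%N ->
  exists x, [/\ forall k, `|x k| = 1, \prod_k x k = 1 & `|psi x i| < 1].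
Proof.
case/andP=> m_gt0 m_lt_n; have n_gt0 : (0 < n)%N by exact: leq_ltn_trans m_lt_n.
have [w jwi] := col_neq0 i; have iw := mem_suppl n_gt0 jwi.
(* [0 < m] leaves room for [p] besides [i], and [m < n] for [q] outside the support. *)
have [p pw pi] : exists2 p, p \in suppl w & p != i.
  have : (0 < #|suppl w :\ i|)%N.
    by rewrite -(ltn_add2l (i \in suppl w)) -cardsD1 card_suppl iw addn0.
  by case/card_gt0P => p; rewrite in_setD1 => /andP[pi pw]; exists p.
have [q qw] : exists q, q \notin suppl w.
  have : (0 < #|~: suppl w|)%N.
    by rewrite -subn_gt0 in m_lt_n; rewrite cardsCs finset.setCK card_ord card_suppl subSS.
  by case/card_gt0P => q; rewrite finset.in_setC; exists q.
have qi : q != i by apply: contraNneq qw => ->.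
have pq : p != q by apply: contraNneq qw => <-.
have [w' [w'E jw'i]] : exists w', suppl w' = tperm p q @: suppl w /\ j w' i != 0.
  by apply: transposition_neq0; rewrite // eq_sym.
have iw' := mem_suppl n_gt0 jw'i.
have pw' : p \notin suppl w'.
  rewrite w'E; apply: contra qw => /imsetP[k kw pk].
  by have := congr1 (tperm p q) pk; rewrite tpermK tpermL => ->.
(* Two sign changes keep the product 1; the monomial is 1 at [w], containing [i] and [p], and -1 at
   [w'], containing only [i] of the two. *)
pose x k : C := (-1) ^+ (k == i) * (-1) ^+ (k == p).
exists x; split.
- by move=> k; rewrite normrM !normrX normrN1 !expr1n mulr1.
- by rewrite big_split /= !prod_expr_eq mulrNN mulr1.
pose e v : C := (-1) ^+ (i \in suppl v) * (-1) ^+ (p \in suppl v).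
have psiE : psi x i = \sum_v `|j v i| ^+ 2 * e v.
  by apply: eq_bigr => v _; rewrite big_split /= !prod_expr_eq.
have eE v : e v = (-1) ^+ ((i \in suppl v) (+) (p \in suppl v)).
  by rewrite signr_addb.
have e_real v : e v \is Num.real.
  by rewrite eE; case: (_ (+) _); rewrite ?expr1 ?expr0 ?realN real1.
have p_ge0 v : 0 <= `|j v i| ^+ 2 by exact: exprn_ge0.
have N1_le1 : -1 <= 1 :> C by rewrite (le_trans (lerN10 _))// ler01.
have e_le1 v : e v <= 1 by rewrite eE; case: (_ (+) _); rewrite ?expr1 ?expr0.
have e_geN1 v : - 1 <= e v by rewrite eE; case: (_ (+) _); rewrite ?expr1 ?expr0.
have jgt0 v : j v i != 0 -> 0 < `|j v i| ^+ 2.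
  by move=> jv; rewrite exprn_gt0// normr_gt0.
rewrite real_ltr_norml; last first.
  by rewrite psiE rpred_sum// => v _; rewrite rpredM// ger0_real.
rewrite psiE -(col_norm i); apply/andP; split.
- rewrite -sumrN (bigD1 w)// [ltRHS](bigD1 w)//=; apply: ltr_leD.
    by rewrite eE iw pw /= mulr1 gtrN// jgt0.
  by apply: ler_sum => v _; rewrite -mulrN1 ler_wpM2l.
- rewrite (bigD1 w')// [ltRHS](bigD1 w')//=; apply: ltr_leD.
    by rewrite eE iw' (negbTE pw') /= mulrN1 gtrN// jgt0.
  by apply: ler_sum => v _; rewrite -[leRHS]mulr1 ler_wpM2l.
Qed.

(** With [a] and [b'] the products of [d] over the left and right supports,
    [a / b' = a ^+ 2 / (a * b')], and [a * b'] is [d 0 i] by [equivariant_weight]. *)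
Lemma compress_torus (d : 'rV[C]_n.+1) i : (forall k, d 0 k != 0) ->
  \prod_k d 0 k = 1 ->
  (j^t* *m actV m (diag_mx d, diag_mx (\row_k (d 0 k)^-1)) *m j) i i =
  (d 0 i)^-1 * psi (fun k => d 0 k ^+ 2) i.
Proof.
move=> d0 d1; rewrite -mulmxA actV_diag mxE mulr_sumr; apply: eq_bigr => w _.
rewrite mul_diag_mx !mxE; have [->|jwi] := eqVneq (j w i) 0.
  by rewrite normr0 expr0n mul0r !mulr0.
rewrite normCK -(equivariant_weight jwi d1).
have -> : \prod_(k in suppr w) (\row_k (d 0 k)^-1 : 'rV_n.+1) 0 k =
    (\prod_(k in suppr w) d 0 k)^-1.
  by rewrite -prodfV; apply: eq_bigr => k _; rewrite mxE.
rewrite prodrXl invfM.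
set a := \prod_(k in suppl w) _; have a0 : a != 0 by apply/prodf_neq0.
set b := (\prod_(k in suppr w) _)^-1; set c := j w i.
rewrite -{1}[a](mulKf a0) -[a * a]expr2; set c' := c^*; set a' := a^-1.
by ring.
Qed.

End Module.

(** * The weight as a function of the squared torus coordinates *)

Lemma torus_sqrt (C : numClosedFieldType) n (x : 'I_n.+1 -> C) :
  (forall k, `|x k| = 1) -> \prod_k x k = 1 ->
  exists d : 'rV[C]_n.+1,
    [/\ forall k, `|d 0 k| = 1, \prod_k d 0 k = 1 & forall k, d 0 k ^+ 2 = x k].
Proof.
(* The product [e] of the chosen roots satisfies [e ^+ 2 = 1]; multiplying the root at 0 by [e]
   makes the product 1 and keeps the squares. *)
move=> x1 px; pose r k := sqrtC (x k); pose e := \prod_k r k.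
have ee : e ^+ 2 = 1.
  by rewrite -prodrXl -[RHS]px; apply: eq_bigr => k _; rewrite sqrtCK.
have dE k : (r k * e ^+ (k == 0)) ^+ 2 = x k.
  by rewrite exprMn sqrtCK exprAC ee expr1n mulr1.
exists (\row_k (r k * e ^+ (k == 0))); split=> [k||k]; rewrite ?mxE//.
- apply/eqP; rewrite -(@pexpr_eq1 _ _ 2)// -normrX dE x1.
  exact: eqxx.
- under eq_bigr do rewrite mxE.
  rewrite big_split /= -/e (bigD1 0)//= big1 ?mulr1 => [|k /negbTE->//].
  by rewrite -exprS.
Qed.

Lemma invmx_diag (F : fieldType) n (d : 'rV[F]_n) : (forall k, d 0 k != 0) ->
  invmx (diag_mx d) = diag_mx (\row_k (d 0 k)^-1).
Proof.
move=> d0; set e := \row_k _.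
have de : diag_mx d *m diag_mx e = 1%:M.
  rewrite mulmx_diag; apply/matrixP => i k; rewrite !mxE divff//.
have [du _] := mulmx1_unit de.
by rewrite -[LHS]mulmx1 -de mulKmx.
Qed.

Section Gram.
Variables (C : numClosedFieldType) (n : nat).
Variable j : forall m : 'I_n.+1, 'M[C]_(dimV m, n.+1).
Hypothesis j_equivariant : forall m, H_equivariant (j m).
Hypothesis j_isometric : forall m, isometric (j m).

Definition gram (x : 'I_n.+1 -> C) : 'M[C]_n.+1 :=
  \matrix_(m, m') \sum_i (psi (j m) x i)^* * psi (j m') x i.

(** The factors [(d 0 i)^-1] of [Phi0] have modulus 1 and cancel in the Gram product. *)
Lemma gram_torus (x : 'I_n.+1 -> C) :
  (forall k, `|x k| = 1) -> \prod_k x k = 1 ->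
  exists2 a, A_c a & (Phi0 j a)^t* *m Phi0 j a = gram x.
Proof.
move=> x1 px; have [d [d1 pd dx]] := torus_sqrt x1 px.
have d0 k : d 0 k != 0 by rewrite -normr_eq0 d1 oner_eq0.
exists (diag_mx d, invmx (diag_mx d)).
  exists (diag_mx d); split=> //; last by rewrite det_diag.
  apply/unitarymxP; apply/matrixP => i k; rewrite mul_diag_mx !mxE.
  rewrite eq_sym; case: eqP => [->|]; last by rewrite conjC0 mulr0.
  by rewrite -normCK d1 expr1n.
have PhiE i m : Phi0 j (diag_mx d, invmx (diag_mx d)) i m =
    (d 0 i)^-1 * psi (j m) x i.
  rewrite mxE invmx_diag// compress_torus//; congr (_ * _).
  by apply: eq_bigr => w _; congr (_ * _); apply: eq_bigr.
apply/matrixP => m m'; rewrite mxE [RHS]mxE; apply: eq_bigr => i _.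
rewrite mxE [in X in X * _]mxE !PhiE rmorphM /= mulrACA fmorphV -invfM.
by rewrite [_^* * d 0 i]mulrC -normCK d1 expr1n invr1 mul1r.
Qed.

(** [psi (j m)] is homogeneous of degree [m.+1], and conjugation inverts [z]. *)
Lemma gram_twist (z : C) x (s : nat) m m' : `|z| = 1 ->
  gram (fun k => z ^+ s * x k) m m' = (z ^+ m' / z ^+ m) ^+ s * gram x m m'.
Proof.
move=> z1; rewrite !mxE mulr_sumr; apply: eq_bigr => i _.
rewrite !psi_scale rmorphM /= mulrACA; congr (_ * _).
rewrite !rmorphXn /= -[z^*]mul1r; have -> : z^* = z^-1.
  by rewrite invC_norm z1 expr1n invr1 mul1r.
rewrite mul1r -!exprM ![(s * _)%N]mulnC !exprM -exprMn; congr (_ ^+ _).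
have z0 : z != 0 by rewrite -normr_eq0 z1 oner_eq0.
by rewrite exprVn !exprS invfM mulrACA mulVf// mul1r mulrC.
Qed.

Lemma gram_indecomposable A : (2 <= n)%N ->
  (forall x, (forall k, `|x k| = 1) -> \prod_k x k = 1 ->
     A *m gram x = gram x *m A^t*) ->
  is_scalar_mx A.
Proof.
move=> n_ge2 AW; have n_gt0 : (0 < n)%N by exact: ltnW.
have [z z_prim] := @primitive_root_exists C n.+1 isT.
have z1 : `|z| = 1.
  apply/eqP; rewrite -(@pexpr_eq1 _ _ n.+1)// -normrX (prim_expr_order z_prim).
  by rewrite normr1.
pose X : set ('I_n.+1 -> C) :=
  [set x | (forall k, `|x k| = 1) /\ \prod_k x k = 1].
apply: (@scalar_intertwiner C n z n.+1%:R X gram A n_ge2 z_prim).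
- by rewrite pnatr_eq0.
- by split=> [k|]; rewrite ?normr1// big1.
- apply/matrixP => m m'; rewrite !mxE.
  under eq_bigr do rewrite !psi1// conjC1 mulr1.
  by rewrite sumr_const card_ord.
- move=> x s [x1 px]; split=> [k|].
    by rewrite normrM normrX z1 expr1n mul1r.
  rewrite big_split /= px mulr1 prodr_const card_ord exprAC.
  by rewrite (prim_expr_order z_prim) expr1n.
- by move=> x s i k _; exact: gram_twist.
- move=> x [x1 px]; rewrite mxE.
  under eq_bigr do rewrite psi_ord0// mulrC -normCK x1 expr1n.
  by rewrite sumr_const card_ord.
- move=> l l_lt; have [x [x1 px psi_lt]] :=
    psi_lt1 (j_equivariant l) (j_isometric l) 0 l_lt.
  exists x => //; rewrite mxE lt_eqF//.
  under eq_bigr do rewrite mulrC -normCK.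
  (* The diagonal entry sums [|psi| ^+ 2] over the rows: strictly below 1 in row 0, at most 1
     elsewhere. *)
  have -> : n.+1%:R = \sum_(i < n.+1) 1 :> C by rewrite sumr_const card_ord.
  rewrite (bigD1 0)// [ltRHS](bigD1 0)//=; apply: ltr_leD.
    by rewrite expr_lt1.
  by apply: ler_sum => i _; rewrite expr_le1// psi_norm_le1.
- by move=> x [x1 px]; exact: AW.
Qed.

End Gram.

Theorem corollary6p21 (R : realType) (n : nat) (n_ge2 : (2 <= n)%N)
    (j : forall m : 'I_n.+1, 'M[R[i]]_(dimV m, n.+1))
    (j_equivariant : forall m : 'I_n.+1, H_equivariant (j m))
    (j_isometric : forall m : 'I_n.+1, isometric (j m))
    (Wpol : 'M[{mpoly R[i][n]}]_n.+1)
    (WpolE : forall a : 'M[R[i]]_n.+1 * 'M[R[i]]_n.+1, A_c a ->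
       mpolymx_eval Wpol (phi a) = (Phi0 j a)^t* *m Phi0 j a) :
  matrix_weight (@phi _ n @` @A_c _ n) (mpolymx_eval Wpol) /\
  indecomposable (@phi _ n @` @A_c _ n) (mpolymx_eval Wpol).
Proof.
split=> [_ [a Aa <-]|]; first by rewrite WpolE// conjCtM trmxCK.
move=> /(decomposable_intertwiner (ltn0Sn n))[A [/negP A_nscalar AW]].
apply: A_nscalar; apply: (gram_indecomposable j_equivariant j_isometric n_ge2).
(* Every such [x] lifts to a point [a] of [A_c], where the relation at [phi a] is the one for
   [gram x]. *)
move=> x x1 px; have [a Aa <-] := gram_torus j_equivariant x1 px.
by rewrite -WpolE//; apply: AW; exists a.
Qed.
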